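(* Let $(F:\mathcal{C}\to\mathcal{D},\,G:\mathcal{D}\to\mathcal{C})$ be an adjunction ($F$ left adjoint to $G$) with unit $\eta$ and counit $\epsilon$. Then $G$ is semiseparable if and only if the forgetful functor $U_{GF}:\mathcal{C}_{GF}\to\mathcal{C}$ is separable (equivalently, the monad $(GF,G\epsilon F,\eta)$ is separable) and the comparison functor $K_{GF}:\mathcal{D}\to\mathcal{C}_{GF}$ is naturally full.
   Context: For a functor $F:\mathcal{C}\to\mathcal{D}$ let $\mathcal{F}^F:\mathrm{Hom}_{\mathcal{C}}(-,-)\to\mathrm{Hom}_{\mathcal{D}}(F-,F-)$ be the natural transformation (of functors $\mathcal{C}^{\mathrm{op}}\times\mathcal{C}\to\mathsf{Set}$) with $\mathcal{F}^F_{X,Y}(f)=F(f)$. $F$ is separable if there is a natural transformation $\mathcal{P}^F:\mathrm{Hom}_{\mathcal{D}}(F-,F-)\to\mathrm{Hom}_{\mathcal{C}}(-,-)$ with $\mathcal{P}^F\circ\mathcal{F}^F=\mathrm{Id}$; naturally full if there is such a $\mathcal{P}^F$ with $\mathcal{F}^F\circ\mathcal{P}^F=\mathrm{Id}$; semiseparable if there is such a $\mathcal{P}^F$ with $\mathcal{F}^F\circ\mathcal{P}^F\circ\mathcal{F}^F=\mathcal{F}^F$. $\mathcal{C}_{GF}$ is the Eilenberg–Moore category of modules (algebras) over the monad $(GF,G\epsilon F,\eta)$ on $\mathcal{C}$, $U_{GF}$ its forgetful functor, and $K_{GF}:\mathcal{D}\to\mathcal{C}_{GF}$ is the comparison functor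 $D\mapsto(GD,G\epsilon_D)$, $f\mapsto G(f)$. A monad $(\top,m:\top\top\to\top,\eta:\mathrm{Id}_{\mathcal{C}}\to\top)$ is separable if there is a natural transformation $\sigma:\top\to\top\top$ with $m\circ\sigma=\mathrm{Id}_{\top}$ and $\top m\circ\sigma\top=\sigma\circ m=m\top\circ\top\sigma$. *)

(* Defs.v *)
From Stdlib Require Import ProofIrrelevance.

Set Implicit Arguments.
Unset Strict Implicit.
Unset Printing Implicit Defensive.

Declare Scope cat_scope.
Delimit Scope cat_scope with cat.
Local Open Scope cat_scope.

Record Category : Type := {
  Ob :> Type;
  Hom : Ob -> Ob -> Type;
  idm : forall X, Hom X X;
  comp : forall X Y Z, Hom Y Z -> Hom X Y -> Hom X Z;
  comp_idl : forall X Y (f : Hom X Y), comp (idm Y) f = f;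
  comp_idr : forall X Y (f : Hom X Y), comp f (idm X) = f;
  comp_assoc : forall W X Y Z (h : Hom Y Z) (g : Hom X Y) (f : Hom W X),
    comp h (comp g f) = comp (comp h g) f
}.
Arguments Hom {c} X Y.
Arguments idm {c} X.
Arguments comp {c X Y Z} g f.
Arguments comp_idl {c X Y} f.
Arguments comp_idr {c X Y} f.
Arguments comp_assoc {c W X Y Z} h g f.

(* [g ∘ f] is "g after f". *)
Notation "g ∘ f" := (comp g f) (at level 40, left associativity) : cat_scope.

Record Functor (C D : Category) : Type := {
  fob :> C -> D;
  fmap : forall X Y : C, Hom X Y -> Hom (fob X) (fob Y);
  fmap_id : forall X : C, fmap (idm X) = idm (fob X);
  fmap_comp : forall (X Y Z : C) (g : Hom Y Z) (f : Hom X Y),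
    fmap (g ∘ f) = fmap g ∘ fmap f
}.
Arguments fmap {C D} F {X Y} f : rename.
Arguments fmap_id {C D} F X : rename.
Arguments fmap_comp {C D} F {X Y Z} g f : rename.

Definition id_functor (C : Category) : Functor C C := {|
  fob := fun X => X;
  fmap := fun X Y f => f;
  fmap_id := fun X => eq_refl;
  fmap_comp := fun X Y Z g f => eq_refl
|}.

Definition comp_functor (C D E : Category) (G : Functor D E) (F : Functor C D) :
  Functor C E := {|
  fob := fun X => G (F X);
  fmap := fun X Y f => fmap G (fmap F f);
  fmap_id := fun X => eq_trans (f_equal (fmap G) (fmap_id F X)) (fmap_id G (F X));
  fmap_comp := fun X Y Z g f =>
    eq_trans (f_equal (fmap G) (fmap_comp F g f))
             (fmap_comp G (fmap F g) (fmap F f))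
|}.
Notation "G ∘F F" := (comp_functor G F) (at level 40, left associativity) : cat_scope.

Record NatTrans (C D : Category) (F G : Functor C D) : Type := {
  ntc :> forall X : C, Hom (F X) (G X);
  ntc_nat : forall (X Y : C) (f : Hom X Y), ntc Y ∘ fmap F f = fmap G f ∘ ntc X
}.
Arguments ntc_nat {C D F G} t {X Y} f : rename.

(* A natural transformation P : Hom_D(F-,F-) -> Hom_C(-,-) of functors
   C^op x C -> Set; [homback_nat] is the naturality square at the morphism (a, b)
   of C^op x C.  The transformation F^F in the other direction is [fmap F]. *)
Record HomBack (C D : Category) (F : Functor C D) : Type := {
  homback : forall X Y : C, Hom (F X) (F Y) -> Hom X Y;
  homback_nat : forall (X X' Y Y' : C) (a : Hom X' X) (b : Hom Y Y')
    (g : Hom (F X) (F Y)),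
    homback (fmap F b ∘ g ∘ fmap F a) = b ∘ homback g ∘ a
}.
Arguments homback {C D F} P {X Y} g : rename.
Arguments homback_nat {C D F} P {X X' Y Y'} a b g : rename.

Definition separable (C D : Category) (F : Functor C D) : Prop :=
  exists P : HomBack F, forall (X Y : C) (f : Hom X Y), homback P (fmap F f) = f.

Definition naturally_full (C D : Category) (F : Functor C D) : Prop :=
  exists P : HomBack F,
    forall (X Y : C) (g : Hom (F X) (F Y)), fmap F (homback P g) = g.

Definition semiseparable (C D : Category) (F : Functor C D) : Prop :=
  exists P : HomBack F,
    forall (X Y : C) (f : Hom X Y), fmap F (homback P (fmap F f)) = fmap F f.

Record Adjunction (C D : Category) (F : Functor C D) (G : Functor D C) : Type := {
  unit : NatTrans (id_functor C) (G ∘F F);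
  counit : NatTrans (F ∘F G) (id_functor D);
  triangle_l : forall X : C, counit (F X) ∘ fmap F (unit X) = idm (F X);
  triangle_r : forall A : D, fmap G (counit A) ∘ unit (G A) = idm (G A)
}.
Arguments triangle_l {C D F G} a X : rename.
Arguments triangle_r {C D F G} a A : rename.

Record Monad (C : Category) : Type := {
  mfun :> Functor C C;
  mmul : NatTrans (mfun ∘F mfun) mfun;
  munit : NatTrans (id_functor C) mfun;
  mmul_assoc : forall X : C, mmul X ∘ fmap mfun (mmul X) = mmul X ∘ mmul (mfun X);
  mmul_unitl : forall X : C, mmul X ∘ munit (mfun X) = idm (mfun X);
  mmul_unitr : forall X : C, mmul X ∘ fmap mfun (munit X) = idm (mfun X)
}.
Arguments mmul_assoc {C} T X : rename.
Arguments mmul_unitl {C} T X : rename.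
Arguments mmul_unitr {C} T X : rename.

(* The equations are m ∘ σ = Id and Tm ∘ σT = σ ∘ m = mT ∘ Tσ. *)
Definition separable_monad (C : Category) (T : Monad C) : Prop :=
  exists σ : NatTrans T (T ∘F T),
    forall X : C,
      mmul T X ∘ σ X = idm (T X) /\
      fmap T (mmul T X) ∘ σ (T X) = σ X ∘ mmul T X /\
      σ X ∘ mmul T X = mmul T (T X) ∘ fmap T (σ X).

Section EilenbergMoore.
Variables (C : Category) (T : Monad C).

Record EMOb : Type := {
  em_car : C;
  em_act : Hom (T em_car) em_car;
  em_act_unit : em_act ∘ munit T em_car = idm em_car;
  em_act_mul : em_act ∘ mmul T em_car = em_act ∘ fmap T em_act
}.

Record EMHom (A B : EMOb) : Type := {
  em_map : Hom (em_car A) (em_car B);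
  em_map_act : em_map ∘ em_act A = em_act B ∘ fmap T em_map
}.

Lemma EMHom_eq (A B : EMOb) (f g : EMHom A B) : em_map f = em_map g -> f = g.
Proof.
destruct f as [f pf], g as [g pg]; simpl; intros e; subst g.
now rewrite (proof_irrelevance _ pf pg).
Qed.

Lemma EM_id_act (A : EMOb) :
  idm (em_car A) ∘ em_act A = em_act A ∘ fmap T (idm (em_car A)).
Proof. now rewrite fmap_id, comp_idl, comp_idr. Qed.

Lemma EM_comp_act (A B E : EMOb) (g : EMHom B E) (f : EMHom A B) :
  (em_map g ∘ em_map f) ∘ em_act A = em_act E ∘ fmap T (em_map g ∘ em_map f).
Proof.
now rewrite fmap_comp, <- comp_assoc, (em_map_act f), !comp_assoc, (em_map_act g).
Qed.

Definition EM_id (A : EMOb) : EMHom A A :=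
  {| em_map := idm (em_car A); em_map_act := EM_id_act A |}.

Definition EM_comp (A B E : EMOb) (g : EMHom B E) (f : EMHom A B) : EMHom A E :=
  {| em_map := em_map g ∘ em_map f; em_map_act := EM_comp_act g f |}.

Lemma EM_comp_idl (A B : EMOb) (f : EMHom A B) : EM_comp (EM_id B) f = f.
Proof. apply EMHom_eq, comp_idl. Qed.

Lemma EM_comp_idr (A B : EMOb) (f : EMHom A B) : EM_comp f (EM_id A) = f.
Proof. apply EMHom_eq, comp_idr. Qed.

Lemma EM_comp_assoc (A B E K : EMOb) (h : EMHom E K) (g : EMHom B E)
  (f : EMHom A B) : EM_comp h (EM_comp g f) = EM_comp (EM_comp h g) f.
Proof. apply EMHom_eq, comp_assoc. Qed.

Definition EM : Category := {|
  Ob := EMOb;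
  Hom := EMHom;
  idm := EM_id;
  comp := EM_comp;
  comp_idl := EM_comp_idl;
  comp_idr := EM_comp_idr;
  comp_assoc := EM_comp_assoc
|}.

Definition EM_forget : Functor EM C := {|
  fob := (em_car : EM -> C);
  fmap := fun (A B : EM) (f : Hom A B) => em_map f;
  fmap_id := fun A => eq_refl;
  fmap_comp := fun A B E g f => eq_refl
|}.
End EilenbergMoore.

Section AdjunctionMonad.
Variables (C D : Category) (F : Functor C D) (G : Functor D C).
Variable adj : Adjunction F G.

Lemma GcounitF_nat (X Y : C) (f : Hom X Y) :
  fmap G (counit adj (F Y)) ∘ fmap ((G ∘F F) ∘F (G ∘F F)) f =
  fmap (G ∘F F) f ∘ fmap G (counit adj (F X)).
Proof.
cbn; rewrite <- !fmap_comp; apply f_equal.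
exact (ntc_nat (counit adj) (fmap F f)).
Qed.

Definition GcounitF : NatTrans ((G ∘F F) ∘F (G ∘F F)) (G ∘F F) := {|
  ntc := fun X : C =>
    (fmap G (counit adj (F X)) : Hom (((G ∘F F) ∘F (G ∘F F)) X) ((G ∘F F) X));
  ntc_nat := GcounitF_nat
|}.

Lemma Gcounit_assoc (A : D) :
  fmap G (counit adj A) ∘ fmap (G ∘F F) (fmap G (counit adj A)) =
  fmap G (counit adj A) ∘ fmap G (counit adj (F (G A))).
Proof.
cbn; rewrite <- !fmap_comp; apply f_equal.
exact (ntc_nat (counit adj) (counit adj A)).
Qed.

Lemma GcounitF_unitr (X : C) :
  fmap G (counit adj (F X)) ∘ fmap (G ∘F F) (unit adj X) = idm (G (F X)).
Proof.
cbn; rewrite <- fmap_comp, <- fmap_id; apply f_equal.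
exact (triangle_l adj X).
Qed.

Definition adj_monad : Monad C := {|
  mfun := G ∘F F;
  mmul := GcounitF;
  munit := unit adj;
  mmul_assoc := fun X => Gcounit_assoc (F X);
  mmul_unitl := fun X => triangle_r adj (F X);
  mmul_unitr := GcounitF_unitr
|}.

Definition comparison_ob (A : D) : EM adj_monad := {|
  em_car := G A;
  em_act := (fmap G (counit adj A) : Hom (adj_monad (G A)) (G A));
  em_act_unit := triangle_r adj A;
  em_act_mul := eq_sym (Gcounit_assoc A)
|}.

Lemma comparison_act (A B : D) (f : Hom A B) :
  fmap G f ∘ fmap G (counit adj A) =
  fmap G (counit adj B) ∘ fmap (G ∘F F) (fmap G f).
Proof.
cbn; rewrite <- !fmap_comp; apply f_equal.
symmetry; exact (ntc_nat (counit adj) f).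
Qed.

Definition comparison_map (A B : D) (f : Hom A B) :
  Hom (comparison_ob A) (comparison_ob B) :=
  Build_EMHom (A := comparison_ob A) (B := comparison_ob B) (comparison_act f).

Definition comparison : Functor D (EM adj_monad) := {|
  fob := comparison_ob;
  fmap := comparison_map;
  fmap_id := fun A => EMHom_eq (f := comparison_map (idm A))
    (g := idm (comparison_ob A)) (fmap_id G A);
  fmap_comp := fun A B E g f => EMHom_eq (f := comparison_map (g ∘ f))
    (g := comparison_map g ∘ comparison_map f) (fmap_comp G g f)
|}.
End AdjunctionMonad.

(* Main.v *)
(** A right adjoint factors as [G = U ∘ K] through the algebras of its monad
    [T = GF].  If [P] witnesses semiseparability of [G], then [G (P (η (GF X)))]
    is a separability section of [T]; and for an algebra map [h : K A -> K B] one
    has [h ∘ Gε = G (ε ∘ F h)], so that [G (P h) ∘ Gε = h ∘ Gε], whence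
    [G (P h) = h] because [Gε] is split epi.  Conversely the backward
    transformations for [U] and [K] compose.  If [P] witnesses separability of [U],
    then [P (η (T X))] is a separability section of [T]; conversely a section [σ]
    gives each algebra [(A, a)] the algebra map [T a ∘ σ ∘ η : A -> T A] splitting
    [a], natural in [(A, a)]. *)

Require Import Defs.

Set Implicit Arguments.
Unset Strict Implicit.
Unset Printing Implicit Defensive.
Local Open Scope cat_scope.

(** * Backward transformations: one-sided naturality and composition *)

Section HomBackTheory.
Variables (C D : Category) (F : Functor C D) (P : HomBack F).

Lemma homback_post (X Y Y' : C) (b : Hom Y Y') (g : Hom (F X) (F Y)) :
  homback P (fmap F b ∘ g) = b ∘ homback P g.
Proof.
pose proof (homback_nat P (idm X) b g) as H.
now rewrite fmap_id, !comp_idr in H.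
Qed.

Lemma homback_pre (X X' Y : C) (a : Hom X' X) (g : Hom (F X) (F Y)) :
  homback P (g ∘ fmap F a) = homback P g ∘ a.
Proof.
pose proof (homback_nat P a (idm Y) g) as H.
now rewrite fmap_id, !comp_idl in H.
Qed.

End HomBackTheory.

Section Comp.
Variables (C D E : Category) (F : Functor C D) (G : Functor D E).
Variables (P : HomBack F) (Q : HomBack G).

Lemma comp_homback_nat (X X' Y Y' : C) (a : Hom X' X) (b : Hom Y Y')
    (g : Hom ((G ∘F F) X) ((G ∘F F) Y)) :
  homback P (homback Q (fmap (G ∘F F) b ∘ g ∘ fmap (G ∘F F) a)) =
  b ∘ homback P (homback Q g) ∘ a.
Proof. cbn; rewrite homback_nat; apply homback_nat. Qed.

Definition comp_homback : HomBack (G ∘F F) := {|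
  homback := fun (X Y : C) (g : Hom ((G ∘F F) X) ((G ∘F F) Y)) =>
    homback P (homback Q g);
  homback_nat := comp_homback_nat
|}.

End Comp.

Lemma semiseparable_comp (C D E : Category) (F : Functor C D) (G : Functor D E) :
  naturally_full F -> separable G -> semiseparable (G ∘F F).
Proof.
intros [P HP] [Q HQ]; exists (comp_homback P Q).
intros X Y f; cbn; now rewrite HQ, HP.
Qed.

(** * Separability of a monad and of its forgetful functor *)

Section FreeAlgebra.
Variables (C : Category) (T : Monad C).

Definition free_ob (X : C) : EM T := {|
  em_car := T X;
  em_act := mmul T X;
  em_act_unit := mmul_unitl T X;
  em_act_mul := eq_sym (mmul_assoc T X)
|}.

Definition free_map (X Y : C) (f : Hom X Y) : Hom (free_ob X) (free_ob Y) :=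
  Build_EMHom (A := free_ob X) (B := free_ob Y) (em_map := fmap T f)
    (eq_sym (ntc_nat (mmul T) f)).

(** The counit at [A] of the free-forgetful adjunction. *)
Definition act_map (A : EM T) : Hom (free_ob (em_car A)) A :=
  Build_EMHom (A := free_ob (em_car A)) (B := A) (em_map := em_act A)
    (em_act_mul A).

End FreeAlgebra.

Section SeparableForget.
Variables (C : Category) (T : Monad C) (P : HomBack (EM_forget T)).

(** The unit at [T X] need not be an algebra map, but [P] turns it into one. *)
Definition forget_section_map (X : C) : Hom (free_ob T X) (free_ob T (T X)) :=
  homback P (X := free_ob T X) (Y := free_ob T (T X)) (munit T (T X)).

(* Both sides are images under [P] of the two sides of the naturality square of
   the unit at the underlying morphism of [f]. *)
Lemma forget_section_map_nat (X Y : C) (f : Hom (free_ob T X) (free_ob T Y)) :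
  forget_section_map Y ∘ f = free_map T (em_map f) ∘ forget_section_map X.
Proof.
unfold forget_section_map.
rewrite <- homback_pre, <- homback_post; apply f_equal.
exact (ntc_nat (munit T) (em_map f)).
Qed.

Definition forget_section : NatTrans T (T ∘F T) := {|
  ntc := fun X : C => (em_map (forget_section_map X) : Hom (T X) ((T ∘F T) X));
  ntc_nat := fun X Y f =>
    f_equal (fun h => em_map h) (forget_section_map_nat (free_map T f))
|}.

End SeparableForget.

Lemma separable_monad_of_forget (C : Category) (T : Monad C) :
  separable (EM_forget T) -> separable_monad T.
Proof.
intros [P HP]; exists (forget_section P); intros X; repeat split.
- transitivity (em_map (idm (free_ob T X))); [|reflexivity].
  (* With the identity written as a value of [P], the two arguments of [P] can be compared in [C],
     where they agree by the left unit law. *)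
  rewrite <- (HP _ _ (idm (free_ob T X))).
  change (em_map (act_map (free_ob T X) ∘ forget_section_map P X) =
    em_map (homback P (fmap (EM_forget T) (idm (free_ob T X))))).
  unfold forget_section_map; rewrite <- homback_post.
  apply (f_equal (fun h => em_map (homback P h))).
  exact (mmul_unitl T X).
(* Naturality of the section at the multiplication, itself an algebra map between free algebras. *)
- symmetry.
  exact (f_equal (fun h => em_map h)
    (forget_section_map_nat P (act_map (free_ob T X)))).
- exact (em_map_act (forget_section_map P X)).
Qed.

Section SeparableMonad.
Variables (C : Category) (T : Monad C) (σ : forall X : C, Hom (T X) (T (T X))).
Hypothesis σ_nat : forall (X Y : C) (f : Hom X Y),
  σ Y ∘ fmap T f = fmap T (fmap T f) ∘ σ X.
Hypothesis σ_sec : forall X : C, mmul T X ∘ σ X = idm (T X).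
Hypothesis σ_left : forall X : C, fmap T (mmul T X) ∘ σ (T X) = σ X ∘ mmul T X.
Hypothesis σ_right : forall X : C, σ X ∘ mmul T X = mmul T (T X) ∘ fmap T (σ X).

Definition act_section (A : EM T) : Hom (em_car A) (T (em_car A)) :=
  fmap T (em_act A) ∘ σ (em_car A) ∘ munit T (em_car A).

(** Naturality of the unit and of [σ] moves the action to the left, where associativity turns it
    into a multiplication; [σ_left] brings that next to the unit, which cancels it.
    [mul_act_section] reaches the same map through [σ_right], so [act_section] is an algebra map. *)
Lemma act_section_act (A : EM T) :
  act_section A ∘ em_act A = fmap T (em_act A) ∘ σ (em_car A).
Proof.
unfold act_section.
pose proof (ntc_nat (munit T) (em_act A)) as Hη.
pose proof (σ_left (em_car A)) as Hl.
pose proof (em_act_mul A) as Ha.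
pose proof (mmul_unitl T (em_car A)) as Hu.
cbn in *.
rewrite <- comp_assoc, Hη, comp_assoc, <- (comp_assoc _ (σ _)), σ_nat.
rewrite comp_assoc, <- fmap_comp, <- Ha, fmap_comp.
now rewrite <- (comp_assoc _ _ (σ _)), Hl, <- !comp_assoc, Hu, comp_idr.
Qed.

Lemma mul_act_section (A : EM T) :
  mmul T (em_car A) ∘ fmap T (act_section A) = fmap T (em_act A) ∘ σ (em_car A).
Proof.
unfold act_section.
pose proof (ntc_nat (mmul T) (em_act A)) as Hm.
pose proof (σ_right (em_car A)) as Hr.
pose proof (mmul_unitr T (em_car A)) as Hu.
cbn in *.
rewrite !fmap_comp, !comp_assoc, Hm.
rewrite <- (comp_assoc _ _ (fmap T (σ _))), <- Hr.
now rewrite <- !comp_assoc, Hu, comp_idr.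
Qed.

Definition act_section_map (A : EM T) : Hom A (free_ob T (em_car A)) :=
  Build_EMHom (A := A) (B := free_ob T (em_car A)) (em_map := act_section A)
    (eq_trans (act_section_act A) (eq_sym (mul_act_section A))).

Lemma act_section_nat (A B : EM T) (f : Hom A B) :
  fmap T (em_map f) ∘ act_section A = act_section B ∘ em_map f.
Proof.
unfold act_section.
pose proof (ntc_nat (munit T) (em_map f)) as Hη; cbn in Hη.
rewrite <- (comp_assoc _ _ (em_map f)), Hη, !comp_assoc.
rewrite <- (comp_assoc _ (σ _) (fmap T _)), σ_nat, comp_assoc, <- !fmap_comp.
now rewrite em_map_act.
Qed.

Lemma act_sectionK (A : EM T) : em_act A ∘ act_section A = idm (em_car A).
Proof.
unfold act_section.
pose proof (em_act_mul A) as Ha.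
pose proof (σ_sec (em_car A)) as Hs.
cbn in *.
rewrite !comp_assoc, <- Ha, <- (comp_assoc _ _ (σ _)), Hs, comp_idr.
apply em_act_unit.
Qed.

(** The analogue of averaging a linear map in Maschke's theorem: [g] is made into an algebra map
    along [A -> T A -> T B -> B]. *)
Definition monad_back (A B : EM T) (g : Hom (em_car A) (em_car B)) : Hom A B :=
  act_map B ∘ free_map T g ∘ act_section_map A.

Lemma monad_back_nat (A A' B B' : EM T) (a : Hom A' A) (b : Hom B B')
    (g : Hom (EM_forget T A) (EM_forget T B)) :
  monad_back (fmap (EM_forget T) b ∘ g ∘ fmap (EM_forget T) a) =
  b ∘ monad_back g ∘ a.
Proof.
apply EMHom_eq; cbn.
rewrite !fmap_comp, <- !comp_assoc, act_section_nat, !comp_assoc.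
now rewrite (em_map_act b).
Qed.

Definition monad_homback : HomBack (EM_forget T) := {|
  homback := (monad_back : forall A B : EM T,
    Hom (EM_forget T A) (EM_forget T B) -> Hom A B);
  homback_nat := monad_back_nat
|}.

Lemma monad_back_forget (A B : EM T) (f : Hom A B) : monad_back (em_map f) = f.
Proof.
apply EMHom_eq; cbn.
now rewrite <- em_map_act, <- comp_assoc, act_sectionK, comp_idr.
Qed.

End SeparableMonad.

Lemma separable_forgetP (C : Category) (T : Monad C) :
  separable (EM_forget T) <-> separable_monad T.
Proof.
split; [apply separable_monad_of_forget|].
intros [σ Hσ].
exists (monad_homback (@ntc_nat _ _ _ _ σ) (fun X => proj1 (proj2 (Hσ X)))
  (fun X => proj2 (proj2 (Hσ X)))).
apply monad_back_forget; intros X; apply (Hσ X).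
Qed.

(** * Consequences of semiseparability of a right adjoint *)

Section SemiseparableRightAdjoint.
Variables (C D : Category) (F : Functor C D) (G : Functor D C).
Variables (adj : Adjunction F G) (P : HomBack G).
Hypothesis P_semi : forall (A B : D) (f : Hom A B),
  fmap G (homback P (fmap G f)) = fmap G f.

(** Applying [P] to the naturality square of the unit at [G f] yields a natural transformation from
    the identity of [D] to [FG]. *)
Lemma unit_G_nat (A B : D) (f : Hom A B) :
  homback P (unit adj (G B)) ∘ f =
  fmap F (fmap G f) ∘ homback P (unit adj (G A)).
Proof.
rewrite <- homback_pre, <- homback_post; apply f_equal.
exact (ntc_nat (unit adj) (fmap G f)).
Qed.

Lemma adj_section_nat (X Y : C) (f : Hom X Y) :
  fmap G (homback P (unit adj (G (F Y)))) ∘ fmap (G ∘F F) f =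
  fmap ((G ∘F F) ∘F (G ∘F F)) f ∘ fmap G (homback P (unit adj (G (F X)))).
Proof. cbn; rewrite <- !fmap_comp; apply f_equal, unit_G_nat. Qed.

Definition adj_section : NatTrans (G ∘F F) ((G ∘F F) ∘F (G ∘F F)) := {|
  ntc := fun X : C =>
    (fmap G (homback P (unit adj (G (F X)))) :
       Hom ((G ∘F F) X) (((G ∘F F) ∘F (G ∘F F)) X));
  ntc_nat := adj_section_nat
|}.

Lemma adj_separable_monad : separable_monad (adj_monad adj).
Proof.
exists adj_section; intros X; cbn; repeat split.
- pose proof (triangle_r adj (F X)) as Ht; cbn in Ht.
  (* The triangle identity reduces the argument of [P] to an identity, hence to an image under [G],
     as [P_semi] requires. *)
  rewrite <- fmap_comp, <- homback_post, Ht, <- fmap_id.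
  apply P_semi.
(* Naturality of [P η] at the counit; the last equation is naturality of the counit at [P η]. *)
- rewrite <- !fmap_comp; apply f_equal; symmetry; apply unit_G_nat.
- rewrite <- !fmap_comp; apply f_equal; symmetry.
  exact (ntc_nat (counit adj) (homback P (unit adj (G (F X))))).
Qed.

Lemma fmap_homback_comparison (A B : D)
    (h : Hom (comparison adj A) (comparison adj B)) :
  fmap G (homback P (em_map h)) = em_map h.
Proof.
assert (E : fmap G (homback P (em_map h)) ∘ fmap G (counit adj A) =
            em_map h ∘ fmap G (counit adj A)).
{ transitivity (fmap G (homback P (em_map h ∘ fmap G (counit adj A)))).
  - transitivity (fmap G (homback P (em_map h) ∘ counit adj A)).
    + symmetry; apply fmap_comp.
    + apply f_equal; symmetry.
      exact (homback_pre P (counit adj A) (em_map h)).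
  - pose proof (em_map_act h) as Hh; cbn in Hh |- *.
    rewrite Hh, <- fmap_comp; apply P_semi. }
apply (f_equal (fun k => k ∘ unit adj (G A))) in E.
rewrite <- !comp_assoc in E.
pose proof (triangle_r adj A) as Ht; cbn in Ht, E.
now rewrite Ht, !comp_idr in E.
Qed.

Lemma comparison_homback_nat (A A' B B' : D) (a : Hom A' A) (b : Hom B B')
    (h : Hom (comparison adj A) (comparison adj B)) :
  homback P (em_map (fmap (comparison adj) b ∘ h ∘ fmap (comparison adj) a)) =
  b ∘ homback P (em_map h) ∘ a.
Proof. exact (homback_nat P a b (em_map h)). Qed.

Definition comparison_homback : HomBack (comparison adj) := {|
  homback := fun (A B : D) (h : Hom (comparison adj A) (comparison adj B)) =>
    homback P (em_map h);
  homback_nat := comparison_homback_nat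
|}.

Lemma comparison_naturally_full : naturally_full (comparison adj).
Proof.
exists comparison_homback; intros A B h.
apply EMHom_eq, fmap_homback_comparison.
Qed.

End SemiseparableRightAdjoint.

(* [EM_forget ∘F comparison] agrees with [G] on the nose except for its proofs of
   the functor laws, which [HomBack] and [semiseparable] do not see. *)
Lemma semiseparable_of_forget_comparison (C D : Category) (F : Functor C D)
    (G : Functor D C) (adj : Adjunction F G) :
  semiseparable (EM_forget (adj_monad adj) ∘F comparison adj) -> semiseparable G.
Proof.
intros [P HP].
exists {| homback := (@homback _ _ _ P :
            forall A B : D, Hom (G A) (G B) -> Hom A B);
          homback_nat := @homback_nat _ _ _ P |}.
exact HP.
Qed.

Theorem theorem2p9 (C D : Category) (F : Functor C D) (G : Functor D C)
  (adj : Adjunction F G) :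
  (semiseparable G <->
     separable (EM_forget (adj_monad adj)) /\ naturally_full (comparison adj)) /\
  (separable (EM_forget (adj_monad adj)) <-> separable_monad (adj_monad adj)).
Proof.
split; [split|apply separable_forgetP].
- intros [P HP]; split.
  + apply separable_forgetP; exact (adj_separable_monad adj HP).
  + exact (comparison_naturally_full adj HP).
- intros [HU HK].
  exact (semiseparable_of_forget_comparison (semiseparable_comp HK HU)).
Qed.
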